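(* For every $n\ge1$ and every $1\le i\le n$, the poset $\mathrm{M}\Pi^{A'}_{n,i}$ is CL-shellable and Cohen-Macaulay.
   Context: Write $[n]=\{1,\dots,n\}$. A multi-pointed partition of $[n]$ is a partition of $[n]$ into non-empty blocks together with the choice of a non-empty subset of each block, called the pointed subset of this block. The poset $\mathrm{M}\Pi^A_n$ is the set of multi-pointed partitions of $[n]$ with the partial order generated by the following relations: $\pi<\nu$ if $\nu$ is obtained from $\pi$ by gathering two blocks into one, the pointed subset of the new block being either one of the two pointed subsets of the two small blocks or their union (other blocks and their pointed subsets unchanged). Its minimal element $\hat 0$ is the partition into singletons. For $1\le i\le n$, $\mathrm{M}\Pi^{A'}_{n,i}$ is the interval of $\mathrm{M}\Pi^A_n$ between $\hat 0$ and a multi-pointed partition with a single block and $i$ pointed elements (up to isomorphism it does not depend on the choice of the pointed elements). CL-shellable (Björner–Wachs): a finite bounded poset $P$ in which all maximal chains have the same length is CL-shellable if it admits a CL-labelling, i.e. a labelling which assigns to every pair (maximal chain $m$ of $P$, edge of $m$) an element of some totally (or partially) ordered set, such that (1) if two maximal chains coincide along their first $d$ edges, then their labels coincide along these edges; (2) for every interval $[x,y]$ and every unrefinable chain $r$ from $\hat 0$ to $x$, there is a unique maximal chain of $[x,y]$ whose label sequence (computed with root $r$) is increasing, and this label sequence lexicographically precedes those of all other maximal chains of $[x,y]$. Cohen-Macaulay: for $\mathbb{K}$ the ring $\mathbb{Z}$ or any field, for every $x<y$ in the poset the reduced homology with coefficients in $\mathbb{K}$ of the order complex of the open interval $(x,y)$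 vanishes except possibly in top degree $\ell-2$, where $\ell$ is the length of $[x,y]$. *)

(* Defs.v *)
From HB Require Import structures.
From mathcomp Require Import all_boot all_order all_algebra.

Set Implicit Arguments.
Unset Strict Implicit.
Unset Printing Implicit Defensive.

Import Order.TTheory GRing.Theory.

Section ClosedInterval.
Context {d : Order.disp_t} {T : finPOrderType d}.

Record closed_interval (x y : T) (le_xy : (x <= y)%O) :=
  ClosedInterval { interval_val : T; _ : (x <= interval_val <= y)%O }.

Variables (x y : T) (le_xy : (x <= y)%O).

HB.instance Definition _ := [isSub for @interval_val x y le_xy].
HB.instance Definition _ := [Finite of closed_interval le_xy by <:].
HB.instance Definition _ := [SubChoice_isSubPOrder of closed_interval le_xy by <: with d].

Fact interval_bot_subproof : (x <= x <= y)%O. Proof. by rewrite lexx. Qed.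
Fact interval_top_subproof : (x <= y <= y)%O. Proof. by rewrite lexx andbT. Qed.

Fact interval_le0x (z : closed_interval le_xy) :
  (ClosedInterval le_xy interval_bot_subproof <= z)%O.
Proof. by case: z => z zP; case/andP: (zP). Qed.

Fact interval_lex1 (z : closed_interval le_xy) :
  (z <= ClosedInterval le_xy interval_top_subproof)%O.
Proof. by case: z => z zP; case/andP: (zP). Qed.

HB.instance Definition _ :=
  @Order.hasBottom.Build d (closed_interval le_xy) _ interval_le0x.
HB.instance Definition _ :=
  @Order.hasTop.Build d (closed_interval le_xy) _ interval_lex1.

End ClosedInterval.

Section Shellability.
Context {d : Order.disp_t}.

Definition covers (P : finPOrderType d) (x y : P) :=
  (x < y)%O && [forall z : P, ~~ (x < z < y)%O].

(* The chain is given by its elements other than [x], so that [size s] is its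
   length and edge number [j], counted from 0, ends at the [j]-th item of [s]. *)
Definition unrefinable_chain (P : finPOrderType d) (x y : P) (s : seq P) :=
  path (@covers P) x s && (last x s == y).

Definition maximal_chain (P : finTBPOrderType d) (m : seq P) :=
  unrefinable_chain \bot%O \top%O m.

Definition pure_poset (P : finTBPOrderType d) :=
  forall m m' : seq P, maximal_chain m -> maximal_chain m' -> size m = size m'.

(* [lab m j] is the label of edge number [j] of [m]; only maximal chains [m]
   and [j < size m] are relevant.
   In [labels c], the chain [e] from [y] to the top serves only to complete
   [r ++ c] to a maximal chain: by the first clause the labels along [c] do not
   depend on it. *)
Definition CL_labelling (P : finTBPOrderType d) (dL : Order.disp_t)
    (L : porderType dL) (lab : seq P -> nat -> L) :=
  (forall (m m' : seq P) (k : nat), maximal_chain m -> maximal_chain m' ->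
     k <= size m -> k <= size m' -> take k m = take k m' ->
     forall j, j < k -> lab m j = lab m' j)
  /\
  (forall (x y : P) (r e : seq P), (x <= y)%O ->
     unrefinable_chain \bot%O x r -> unrefinable_chain y \top%O e ->
     let labels c : seqlexi L :=
       [seq lab (r ++ c ++ e) j | j <- iota (size r) (size c)] in
     exists c : seq P,
       [/\ unrefinable_chain x y c,
           sorted <%O (labels c : seq L)
         & forall c' : seq P, unrefinable_chain x y c' -> c' <> c ->
             ~~ sorted <%O (labels c' : seq L) /\ (labels c < labels c')%O]).

Definition CL_shellable (P : finTBPOrderType d) :=
  pure_poset P /\
  exists (dL : Order.disp_t) (L : porderType dL) (lab : seq P -> nat -> L),
    CL_labelling lab.

End Shellability.

Section OrderComplex.
Local Open Scope ring_scope.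
Context {d : Order.disp_t} (K : comNzRingType) (P : finPOrderType d) (A : {set P}).

(* Simplices are indexed by their number [k] of vertices, that is by dimension
   plus one, so that [k = 0] is the empty simplex of the augmented complex. *)
Definition simplex (k : nat) :=
  {s : k.-tuple P | sorted <%O s && all (fun z => z \in A) s}.

Definition simplicial_chain (k : nat) := {ffun simplex k -> K}.

Definition face (i : nat) (s : seq P) := take i s ++ drop i.+1 s.

Definition boundary (k : nat) (c : simplicial_chain k.+1) : simplicial_chain k :=
  [ffun s : simplex k => \sum_(t : simplex k.+1)
     \sum_(i < k.+1 | face i (val t) == val s :> seq P) (-1) ^+ i * c t].

Definition is_cycle (k : nat) : simplicial_chain k -> Prop :=
  match k with
  | 0 => fun _ => True
  | _.+1 => fun c => boundary c = 0
  end.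

(* This is reduced homology in degree [k - 1]. *)
Definition reduced_homology_vanishes (k : nat) :=
  forall c : simplicial_chain k, is_cycle c ->
    exists b : simplicial_chain k.+1, boundary b = c.

End OrderComplex.

Section CohenMacaulay.
Context {d : Order.disp_t}.

Definition interval_length (P : finPOrderType d) (x y : P) : nat :=
  \max_(l < #|P| | [exists s : l.-tuple P, path <%O x s && (last x s == y)]) l.

(* Degree [k - 1] is the top degree [interval_length x y - 2] exactly when
   [k.+1 = interval_length x y]. *)
Definition Cohen_Macaulay_over (K : comNzRingType) (P : finPOrderType d) :=
  forall x y : P, (x < y)%O ->
  forall k : nat, k.+1 <> interval_length x y ->
    reduced_homology_vanishes K [set z : P | (x < z < y)%O] k.

Definition Cohen_Macaulay (P : finPOrderType d) :=
  Cohen_Macaulay_over int P /\ forall F : fieldType, Cohen_Macaulay_over F P.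

End CohenMacaulay.

Section MultiPointedPartition.
Variable n : nat.

(* A block is paired with its pointed subset. *)
Definition pointed_block : finType := ({set 'I_n} * {set 'I_n})%type.

Definition is_mpp (p : {set pointed_block}) :=
  [&& partition [set b.1 | b in p] [set: 'I_n],
      [forall b in p, forall c in p, (b.1 == c.1) ==> (b == c)]
    & [forall b in p, (b.2 != set0) && (b.2 \subset b.1)]].

Record mpp := Mpp { mpp_val : {set pointed_block}; _ : is_mpp mpp_val }.

HB.instance Definition _ := [isSub for mpp_val].
HB.instance Definition _ := [Finite of mpp by <:].

Definition merge (p q : mpp) :=
  [exists b in val p, exists c in val p, (b != c) &&
    has (fun Q => val q == (b.1 :|: c.1, Q) |: (val p :\ b :\ c))
        [:: b.2; c.2; b.2 :|: c.2]].

Lemma is_mppP (p : {set pointed_block}) :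
  reflect [/\ forall x, exists2 b, b \in p & x \in b.1,
              forall b c x, b \in p -> c \in p -> x \in b.1 -> x \in c.1 -> b = c
            & forall b, b \in p -> (b.2 != set0) && (b.2 \subset b.1)]
          (is_mpp p).
Proof.
apply: (iffP and3P) => [[/and3P[/eqP cov tI _] inj /forall_inP pt]|[cov inj pt]].
  split=> //.
    move=> x; have: x \in cover [set b.1 | b in p] by rewrite cov inE.
    by case/bigcupP => B /imsetP[b bp ->] xb; exists b.
  move=> b c x bp cp xb xc.
  have e : b.1 = c.1.
    rewrite -(def_pblock tI (imset_f fst bp) xb).
    by rewrite -(def_pblock tI (imset_f fst cp) xc).
  move/forall_inP: inj => /(_ b bp) /forall_inP /(_ c cp).
  by rewrite e eqxx => /eqP.
have ne b : b \in p -> exists x, x \in b.1.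
  by move=> /pt /andP[/set0Pn[x xb] /subsetP s]; exists x; apply: s.
split.
- apply/and3P; split.
  + rewrite -subTset; apply/subsetP => x _; have [b bp xb] := cov x.
    by apply/bigcupP; exists b.1 => //; apply: imset_f.
  + apply/trivIsetP => _ _ /imsetP[b bp ->] /imsetP[c cp ->] nbc.
    rewrite -setI_eq0; apply: contraNT nbc => /set0Pn[x /setIP[xb xc]].
    by rewrite (inj b c x).
  + by apply/imsetP => -[b /ne[x xb] e]; rewrite -e inE in xb.
- apply/forall_inP => b bp; apply/forall_inP => c cp.
  apply/implyP => /eqP e; have [x xb] := ne b bp.
  by apply/eqP; apply: (inj b c x) => //; rewrite -e.
- exact/forall_inP.
Qed.

Lemma merge_card (p q : mpp) : merge p q -> #|val q| < #|val p|.
Proof.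
case/exists_inP => b bp /exists_inP[c cp /andP[nbc /hasP[Q _ /eqP ->]]].
rewrite (cardsD1 b (val p)) bp (cardsD1 c (val p :\ b)) !inE eq_sym nbc cp.
by rewrite cardsU1 !add1n !ltnS -[X in _ <= X]add1n leq_add2r; case: (_ \notin _).
Qed.

Lemma connect_merge_card (p q : mpp) :
  connect merge p q -> p = q \/ #|val q| < #|val p|.
Proof.
case/connectP => s; elim: s p => [|r s IHs] p /=; first by left.
case/andP => /merge_card lt_rp /IHs{}IHs /IHs [<-|lt]; right => //.
exact: ltn_trans lt lt_rp.
Qed.

Fact merge_anti : antisymmetric (connect merge).
Proof.
move=> p q /andP[/connect_merge_card[//|lt_qp] /connect_merge_card[//|]].
by move/(ltn_trans lt_qp); rewrite ltnn.
Qed.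

Fact mpp_display : Order.disp_t. Proof. exact: Order.Disp tt tt. Qed.

HB.instance Definition _ := @Order.Le_isPOrder.Build mpp_display mpp
  (connect merge) (@connect0 _ merge) merge_anti (@connect_trans _ merge).

Fact mpp_bot_subproof :
  is_mpp [set ([set x], [set x]) | x : 'I_n].
Proof.
apply/is_mppP; split.
- by move=> x; exists ([set x], [set x]); rewrite ?inE //; apply: imset_f.
- move=> _ _ x /imsetP[y _ ->] /imsetP[z _ ->] /=.
  by rewrite !inE => /eqP -> /eqP ->.
- move=> _ /imsetP[y _ ->] /=; rewrite subxx andbT.
  by apply/set0Pn; exists y; rewrite inE.
Qed.

Definition mpp_bot : mpp := Mpp mpp_bot_subproof.

Lemma mpp_split (p : mpp) :
  p = mpp_bot \/ exists2 q : mpp, merge q p & #|val p| < #|val q|.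
Proof.
have [cov inj pt] := is_mppP _ (valP p).
have [/exists_inP[b bp b_gt1]|] := boolP [exists b in val p, 1 < #|b.1|]; last first.
  rewrite negb_exists_in => /forall_inP le1; left; apply: val_inj => /=.
  have sing b : b \in val p -> exists x, b = ([set x], [set x]).
    move=> bp; case/andP: (pt b bp) => /set0Pn[x xb2] s21.
    have xb1 := subsetP s21 x xb2.
    have e1 : b.1 = [set x].
      apply/eqP; rewrite eq_sym eqEcard sub1set xb1 cards1 /=.
      by rewrite leqNgt; apply: le1.
    exists x; rewrite [b]surjective_pairing e1; congr pair.
    by apply/eqP; rewrite eqEsubset -{1}e1 s21 sub1set.
  apply/setP => b; apply/idP/imsetP => [/sing[x ->]|[x _ ->]]; first by exists x.
  have [c cp xc] := cov x; have [y ey] := sing c cp.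
  by move: xc cp; rewrite ey inE => /eqP ->.
right; case/andP: (pt b bp) => /set0Pn[x xb2] s21.
have xb1 := subsetP s21 x xb2.
have [y /andP[nyx yb1]] : exists y, (y != x) && (y \in b.1).
  rewrite (cardsD1 x) xb1 ltnS card_gt0 in b_gt1.
  by case/set0Pn: b_gt1 => y; rewrite !inE => ?; exists y.
pose b1 : pointed_block := (b.1 :\ y, b.2 :\ y).
pose b2 : pointed_block := ([set y], [set y]).
pose q := b1 |: (b2 |: (val p :\ b)).
have qP : is_mpp q.
  have rest c z : c \in val p -> c != b -> z \in c.1 -> z \in b.1 -> False.
    by move=> cp /eqP ncb zc zb; apply: ncb; apply: (inj c b z).
  apply/is_mppP; split.
  - move=> z; have [c cp zc] := cov z; have [ecb|ncb] := eqVneq c b.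
      have [->|nzy] := eqVneq z y.
        by exists b2; rewrite ?inE ?eqxx ?orbT.
      by exists b1; rewrite !inE ?eqxx //= nzy -ecb.
    by exists c; rewrite // !inE ncb cp !orbT.
  - move=> c c' z; rewrite !inE.
    case/or3P => [/eqP->|/eqP->|/andP[ncb cp]];
    case/or3P => [/eqP->|/eqP->|/andP[ncb' cp']] //=.
    + by rewrite !inE => /andP[/negbTE ->].
    + by rewrite !inE => /andP[_ zb] zc'; case: (rest c' z).
    + by rewrite !inE => -> .
    + by rewrite !inE => /eqP -> zc'; case: (rest c' y).
    + by rewrite !inE => zc /andP[_ zb]; case: (rest c z).
    + by rewrite !inE => zc /eqP e; rewrite e in zc; case: (rest c y).
    + exact: inj.
  - move=> c; rewrite !inE => /or3P[/eqP->|/eqP->|/andP[_ /pt //]] /=.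
      rewrite setSD // andbT; apply/set0Pn; exists x.
      by rewrite !inE eq_sym nyx.
    by rewrite subxx andbT; apply/set0Pn; exists y; rewrite inE.
have n12 : b1 != b2.
  apply/eqP => -[/setP/(_ y)]; by rewrite !inE eqxx.
have notin (c : pointed_block) z : z \in c.1 -> z \in b.1 -> c \notin val p :\ b.
  move=> zc zb; rewrite !inE; apply/andP => -[/eqP ncb cp]; apply: ncb.
  exact: (inj c b z).
have n1 : b1 \notin val p :\ b by apply: (notin _ x); rewrite ?inE ?xb1 ?(eq_sym x) ?nyx.
have n2 : b2 \notin val p :\ b by apply: (notin _ y); rewrite ?inE.
have m : merge (Mpp qP) p.
  apply/exists_inP; exists b1; first by rewrite !inE eqxx.
  apply/exists_inP; exists b2; first by rewrite !inE eqxx orbT.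
  rewrite n12; apply/hasP; exists b.2.
    have [yb2|nyb2] := boolP (y \in b.2).
      by rewrite !inE [_ :|: _]setUC setD1K ?eqxx ?orbT.
    suff -> : b1.2 = b.2 by rewrite !inE eqxx.
    by apply/setP => z; rewrite !inE; case: eqP => // ->; rewrite (negbTE nyb2).
  rewrite /= [_ :\ y :|: _]setUC setD1K // -surjective_pairing.
  rewrite setU1K; last by rewrite !inE negb_or n12 -in_setD1.
  by rewrite setU1K // setD1K.
by exists (Mpp qP) => //; apply: merge_card.
Qed.

Fact mpp_le0x (p : mpp) : (mpp_bot <= p)%O.
Proof.
have card_le (q : mpp) : #|val q| <= #|{: pointed_block}| by apply: max_card.
have [m] := ubnP (#|{: pointed_block}| - #|val p|).
elim: m p => // m IHm p lt_m; case: (mpp_split p) => [-> //|[q mqp lt_pq]].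
apply: (@le_trans _ _ q); last exact: connect1.
apply: IHm; rewrite -ltnS; apply: leq_trans lt_m; rewrite ltnS.
exact: ltn_sub2l (leq_trans lt_pq (card_le q)) lt_pq.
Qed.

HB.instance Definition _ :=
  @Order.hasBottom.Build mpp_display mpp mpp_bot mpp_le0x.

End MultiPointedPartition.

(* Main.v *)
(* By the theorem of Björner and Wachs, a graded poset in which any two elements that
   cover some [t] and lie below some [v] have a common cover below [v] is CL-shellable and
   Cohen-Macaulay.  For CL-shellability, one labels the edges so that the label
   increases along [w < x < z] exactly when no element preceding [x] among the covers
   of [w] is below [z]: an increasing chain must then take the least atom at each step.
   For the homology, the open interval below [y] is a union of cones [a, y) over the
   atoms, added one at a time; the new cone meets the union of the former ones in the
   filter generated by some atoms of [a, y], so Mayer-Vietoris and induction apply.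

   In multi-pointed partitions [p <= v] holds if and only if each block of [p] lies in
   a block of [v] whose pointed part meets it in the empty set or in its own pointed
   part.  So a block of [v] prescribes how to merge any blocks that it contains, and
   this gives the common cover, except that when its pointed part avoids the blocks
   merged, either the pointed part is chosen by hand or a third block is absorbed. *)
Require Import Defs.
From mathcomp Require Import all_boot all_order all_algebra.
From mathcomp Require Import zify.
Import Order.TTheory GRing.Theory Num.Theory.

Set Implicit Arguments.
Unset Strict Implicit.
Unset Printing Implicit Defensive.

(** * Covers, unrefinable chains and rank functions *)

Section Semimodular.
Context {d : Order.disp_t} (P : finPOrderType d).

Definition graded_by (rho : P -> nat) :=
  (forall x y : P, (x < y)%O -> rho x < rho y) /\
  (forall x y : P, covers x y -> rho y = (rho x).+1).

(** This is semimodularity of all closed intervals at once: [v] is the top of the interval, and a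
    bottom below [t] is automatically below [z]. *)
Definition totally_semimodular :=
  forall t x y v : P, covers t x -> covers t y -> x != y ->
    (x <= v)%O -> (y <= v)%O ->
    exists z, [/\ covers x z, covers y z & (z <= v)%O].

Lemma covers_lt (x y : P) : covers x y -> (x < y)%O.
Proof. by case/andP. Qed.

Lemma covers_le (x y : P) : covers x y -> (x <= y)%O.
Proof. by move/covers_lt/ltW. Qed.

Lemma covers_path_le (x : P) (s : seq P) : path (@covers d P) x s -> (x <= last x s)%O.
Proof.
elim: s x => //= z s IHs x /andP[/covers_le xz /IHs].
exact: le_trans.
Qed.

Lemma unrefinable_cons (x y z : P) (s : seq P) :
  unrefinable_chain x y (z :: s) = covers x z && unrefinable_chain z y s.
Proof. by rewrite /unrefinable_chain /= andbA. Qed.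

Lemma unrefinable_le (x y : P) (s : seq P) : unrefinable_chain x y s -> (x <= y)%O.
Proof. by case/andP => /covers_path_le le /eqP <-. Qed.

Section Graded.
Variable rho : P -> nat.
Hypothesis gr : graded_by rho.

Lemma graded_le (x y : P) : (x <= y)%O -> rho x <= rho y.
Proof. by rewrite le_eqVlt => /predU1P[-> //|/gr.1/ltnW]. Qed.

Lemma exists_atom (x y : P) : (x < y)%O -> exists2 a, covers x a & (a <= y)%O.
Proof.
move=> xy; have inP : (x < y <= y)%O by rewrite xy lexx.
case: (@arg_minnP _ y (fun z => x < z <= y)%O rho inP) => a /andP[xa ay] amin.
exists a; rewrite // /covers xa; apply/forallP => z; apply/negP => /andP[xz za].
have := amin z; rewrite xz (le_trans (ltW za) ay) => /(_ isT).
by rewrite leqNgt (gr.1 _ _ za).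
Qed.

Lemma unrefinable_rank (x y : P) (s : seq P) :
  unrefinable_chain x y s -> rho y = rho x + size s.
Proof.
elim: s x => [x /eqP <-|z s IHs x]; first by rewrite addn0.
by rewrite unrefinable_cons => /andP[/gr.2 rz /IHs ->]; rewrite rz addSnnS.
Qed.

Lemma unrefinable_refl (x : P) (s : seq P) : unrefinable_chain x x s -> s = [::].
Proof.
by move/unrefinable_rank/eqP; rewrite -{1}[rho x]addn0 eqn_add2l eq_sym => /eqP/size0nil.
Qed.

End Graded.
End Semimodular.

(** * CL-shellability of totally semimodular posets *)

Section Labelling.
Context {d : Order.disp_t} (P : finTBPOrderType d) (rho : P -> nat).
Hypotheses (gr : graded_by rho) (sm : totally_semimodular P).
Local Open Scope ring_scope.

(* [edge_label r z] is the label of the edge from the last element of the root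
   to [z], where [r] lists the root in reverse order.  Among the elements covering
   [x], those covering also some element that precedes [x] above its predecessor
   get smaller labels than the edge ending at [x], the others get larger ones. *)
Fixpoint edge_label (r : seq P) (z : P) : int :=
  if r is x :: r' then
    if [exists x', [&& covers (head \bot%O r') x', covers x' z
                     & (edge_label r' x' < edge_label r' x)%R]]
    then edge_label r' x + (enum_rank z)%:Z - #|P|%:Z
    else edge_label r' x + (enum_rank z).+1%:Z
  else (enum_rank z)%:Z.

Fixpoint chain_labels (r c : seq P) : seq int :=
  if c is z :: c' then edge_label r z :: chain_labels (z :: r) c' else [::].

Lemma edge_label_cons (x : P) (r : seq P) (z : P) :
  edge_label (x :: r) z =
    if [exists x', [&& covers (head \bot%O r) x', covers x' z
                     & (edge_label r x' < edge_label r x)%R]]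
    then edge_label r x + (enum_rank z)%:Z - #|P|%:Z
    else edge_label r x + (enum_rank z).+1%:Z.
Proof. by []. Qed.

(** As [enum_rank z < #|P|], the first branch gives labels strictly below the preceding label and
    the second strictly above it; within a branch [enum_rank] separates elements. *)
Lemma edge_label_inj (r : seq P) : injective (edge_label r).
Proof.
have rk (z : P) : (enum_rank z < #|P|)%N by apply: ltn_ord.
case: r => [|x r] z z'.
  by case=> /ord_inj/enum_rank_inj.
rewrite !edge_label_cons; have := rk z; have := rk z'.
by do 2![case: ifP => _]; move=> h h' e; apply/enum_rank_inj/ord_inj; lia.
Qed.

Lemma edge_label_desc (r : seq P) (x x' z : P) :
  covers (head \bot%O r) x' -> covers x' z -> edge_label r x' < edge_label r x ->
  edge_label (x :: r) z < edge_label r x.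
Proof.
move=> cx' cz lt; rewrite edge_label_cons ifT; last by apply/existsP; exists x'; apply/and3P.
have : (enum_rank z < #|P|)%N by apply: ltn_ord.
lia.
Qed.

Lemma edge_label_asc (r : seq P) (x z : P) :
  (forall x', covers (head \bot%O r) x' -> covers x' z ->
     edge_label r x <= edge_label r x') ->
  edge_label r x < edge_label (x :: r) z.
Proof.
move=> min; rewrite edge_label_cons ifF; first by lia.
apply/existsP => -[x' /and3P[cx' cz]].
by rewrite ltNge (min _ cx' cz).
Qed.

Definition least_atom (r : seq P) (x y a : P) :=
  [/\ covers x a, (a <= y)%O
    & forall a', covers x a' -> (a' <= y)%O -> edge_label r a <= edge_label r a'].

Lemma exists_least_atom (r : seq P) (x y : P) :
  (x < y)%O -> exists a, least_atom r x y a.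
Proof.
case/(exists_atom gr) => b xb yb.
have inP : covers x b && (b <= y)%O by rewrite xb.
case: (@Order.TotalTheory.arg_minP _ _ _ b (fun z => covers x z && (z <= y)%O) (edge_label r) inP).
move=> a /andP[xa ay] amin; exists a; split=> // a' xa' ya'.
by apply: amin; rewrite xa'.
Qed.

(** If the least atom [m] were not [a], some [z] below [y] would cover both. As [z] covers the
    earlier [m], its label after [a] drops below that of [a]; by induction the next element [b] is
    least over [a], so its label is at most that of [z], and the chain descends at [a]. *)
Lemma increasing_head (r : seq P) (x y a : P) (c : seq P) :
  head \bot%O r = x -> unrefinable_chain x y (a :: c) ->
  sorted <%R (chain_labels r (a :: c)) -> least_atom r x y a.
Proof.
elim: c r x a => [|b c IHc] r x a hr; rewrite unrefinable_cons => /andP[xa ch] srt;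
  have ay := unrefinable_le ch;
  have [m lm] := exists_least_atom r (lt_le_trans (covers_lt xa) ay);
  have [<- //|nma] := eqVneq m a; case: (lm) => xm my mmin;
  have [z [mz az zy]] := sm xm xa nma my ay.
  (* The chain ends at [a], so [a] is [y] and no [z] covering [a] fits below it. *)
  case/andP: ch => _ /eqP/= ya.
  by have := lt_le_trans (covers_lt az) zy; rewrite -ya ltxx.
have lt_ma : edge_label r m < edge_label r a.
  by rewrite lt_neqAle mmin // (inj_eq (@edge_label_inj r)) nma.
case/andP: srt => lt_ab srt.
have [_ _ /(_ z az zy) le_bz] := IHc (a :: r) a b erefl ch srt.
have := edge_label_desc (z := z) (etrans (congr1 (@covers d P ^~ m) hr) xm) mz lt_ma.
by rewrite ltNge (le_trans (ltW lt_ab) le_bz).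
Qed.

Lemma increasing_uniq (r : seq P) (x y : P) (c c' : seq P) :
  head \bot%O r = x -> unrefinable_chain x y c -> unrefinable_chain x y c' ->
  sorted <%R (chain_labels r c) -> sorted <%R (chain_labels r c') -> c = c'.
Proof.
elim: c r x c' => [|a c IHc] r x c' hr ch ch' srt srt'.
  by case/andP: ch => _ /eqP/= yx; rewrite -yx in ch'; rewrite (unrefinable_refl gr ch').
case: c' ch' srt' => [/andP[_ /eqP/= yx] _|a' c' ch' srt'].
  by rewrite -yx in ch; have := unrefinable_refl gr ch.
have [xa ay amin] := increasing_head hr ch srt.
have [xa' ay' amin'] := increasing_head hr ch' srt'.
have ea : a = a' by apply: (@edge_label_inj r); apply/le_anti; rewrite amin ?amin'.
subst a'; move: ch ch'; rewrite !unrefinable_cons xa /= => ch ch'.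
by rewrite (IHc (a :: r) a c' erefl ch ch' (path_sorted srt) (path_sorted srt')).
Qed.

(** The greedy chain through successive least atoms works: any other chain first leaves it along an
    edge with a strictly larger label, labels being injective. *)
Lemma exists_increasing (r : seq P) (x y : P) :
  head \bot%O r = x -> (x <= y)%O ->
  exists c, [/\ unrefinable_chain x y c, sorted <%R (chain_labels r c)
    & forall c', unrefinable_chain x y c' -> c' <> c ->
        (chain_labels r c < chain_labels r c' :> seqlexi int)%O].
Proof.
have [k] := ubnP (rho y - rho x); elim: k r x => // k IHk r x lek hr.
rewrite le_eqVlt => /predU1P[<-|xy].
  exists [::]; split=> //; first by rewrite /unrefinable_chain /= eqxx.
  by move=> c' /(unrefinable_refl gr).
have [a [xa ay amin]] := exists_least_atom r xy.
have [|c [ch srt cmin]] := IHk (a :: r) a _ erefl ay.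
  by have := gr.2 _ _ xa; have := graded_le gr ay; lia.
exists (a :: c); split.
- by rewrite unrefinable_cons xa.
- case: c {cmin} ch srt => // b c; rewrite unrefinable_cons => /andP[ab /unrefinable_le yb] srt.
  (* Every [x'] covered by [b] lies below [y], so its label is at least that of [a], and the label
     of [b] rises. *)
  apply/andP; split=> //; apply: edge_label_asc => x'; rewrite hr => xx' x'b.
  by apply: amin => //; apply: le_trans (covers_le x'b) yb.
case=> [/andP[_ /eqP/= yx]|a' c']; first by rewrite yx ltxx in xy.
rewrite unrefinable_cons => /andP[xa' ch'] ne; rewrite Order.SeqLexiOrder.Exports.ltxi_cons /=.
have le_aa' := amin a' xa' (unrefinable_le ch').
rewrite le_aa' /=; apply/implyP => le_a'a.
have ea : a = a' by apply: (@edge_label_inj r); apply/le_anti; rewrite le_aa'.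
by rewrite -ea in ch' ne *; apply: cmin => // ec; apply: ne; rewrite ec.
Qed.

Lemma chain_labelsE (r c e : seq P) :
  [seq edge_label (rev (take j (r ++ c ++ e))) (nth \bot%O (r ++ c ++ e) j)
    | j <- iota (size r) (size c)] = chain_labels (rev r) c.
Proof.
elim: c r => //= z c IHc r; rewrite take_size_cat // nth_cat ltnn subnn /=.
by rewrite -rev_rcons -IHc size_rcons cat_rcons.
Qed.

Theorem semimodular_CL_shellable : CL_shellable P.
Proof.
split.
  by move=> m m' /(unrefinable_rank gr) e /(unrefinable_rank gr); rewrite e => /addnI.
exists _, int, (fun m j => edge_label (rev (take j m)) (nth \bot%O m j)); split.
  (* The label of edge [j] uses only the first [j.+1] elements of the chain. *)
  move=> m m' k _ _ lek lek' e j ltj.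
  by rewrite -(nth_take _ ltj) -(@take_takel _ _ _ m (ltnW ltj)) e nth_take // take_takel // ltnW.
move=> x y r e xy ch _ /=.
have hr : head \bot%O (rev r) = x.
  by case/andP: ch => _ /eqP; case/lastP: r => [|r z] //; rewrite last_rcons rev_rcons.
have [c [chc srt cmin]] := exists_increasing hr xy.
exists c; split=> //; first by rewrite chain_labelsE.
move=> c' chc' ne; rewrite !chain_labelsE; split; last exact: cmin.
by apply/negP => srt'; apply: ne; exact: increasing_uniq hr chc' chc srt' srt.
Qed.

End Labelling.

(** * Chains of order complexes *)

Section ChainComplex.
Context {d : Order.disp_t} (K : comNzRingType) (P : finPOrderType d).
Local Open Scope ring_scope.
Implicit Types (A B U V : {set P}) (c b : seq P -> K) (s u : seq P).

(* Chains are coefficient functions on all sequences of elements, so that the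
   complexes of different subsets of [P] live in the same module.  The coefficient
   of [bdry c] at [s] collects those of [c] at the sequences obtained by inserting
   one element in [s], with sign [(-1) ^+ i] for insertion at position [i]. *)
Fixpoint bdry c s : K :=
  \sum_z c (z :: s) - (if s is x :: s' then bdry (fun u => c (x :: u)) s' else 0).

Lemma eq_bdry c b s : c =1 b -> bdry c s = bdry b s.
Proof.
elim: s c b => [|x s IHs] c b e /=; congr (_ - _); try by apply: eq_bigr.
by apply: IHs => u; apply: e.
Qed.

Lemma bdry0 s : bdry (fun=> 0) s = 0.
Proof. by elim: s => [|x s IHs] /=; rewrite big1 // ?IHs subr0. Qed.

Lemma bdryD c b s : bdry (fun u => c u + b u) s = bdry c s + bdry b s.
Proof.
elim: s c b => [|x s IHs] c b /=; rewrite big_split /=; first by rewrite !subr0.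
by rewrite IHs opprD addrACA.
Qed.

Lemma bdryN c s : bdry (fun u => - c u) s = - bdry c s.
Proof.
elim: s c => [|x s IHs] c /=; rewrite sumrN; first by rewrite !subr0.
by rewrite IHs opprB opprK addrC.
Qed.

Lemma bdryB c b s : bdry (fun u => c u - b u) s = bdry c s - bdry b s.
Proof. by rewrite bdryD bdryN. Qed.

Lemma bdry_sum (c : P -> seq P -> K) s :
  bdry (fun u => \sum_z c z u) s = \sum_z bdry (c z) s.
Proof.
elim: s c => [|x s IHs] c /=; rewrite sumrB exchange_big /=; last by rewrite IHs.
by rewrite big1_eq.
Qed.

(** Of the double insertions into [x :: s], two in front of [x] cancel by exchanging them, one on
    each side of [x] by opposite signs, and two behind [x] by induction. *)
Lemma bdry_bdry c s : bdry (bdry c) s = 0.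
Proof.
elim: s c => [|x s IHs] c /=.
  rewrite subr0 sumrB exchange_big /= [X in _ - X](eq_bigr _ (fun _ _ => subr0 _)).
  exact: subrr.
rewrite bdryB IHs subr0 bdry_sum sumrB sumrB exchange_big /=.
by rewrite opprB addrCA subrr addr0 subrr.
Qed.

Lemma bdry_neq0 c s : bdry c s != 0 ->
  exists s1 z s2, s = s1 ++ s2 /\ c (s1 ++ z :: s2) != 0.
Proof.
have head c' s' : \sum_z c' (z :: s') != 0 -> exists z, c' (z :: s') != 0.
  have [/existsP //|/existsPn e] := boolP [exists z, c' (z :: s') != 0].
  by rewrite big1 ?eqxx // => z _; apply/eqP; move: (e z); rewrite negbK.
elim: s c => [|x s IHs] c /=.
  by rewrite subr0 => /head[z cz]; exists [::], z, [::].
have [h0|/head[z cz] _] := eqVneq (\sum_z c (z :: x :: s)) 0; last first.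
  by exists [::], z, (x :: s).
rewrite h0 sub0r oppr_eq0 => /IHs[s1 [z [s2 [-> cz]]]].
by exists (x :: s1), z, s2.
Qed.

Definition chain_on A k c := forall s, c s != 0 ->
  [&& size s == k, sorted <%O s & all (mem A) s].

(** Exactness of the augmented complex at [k] vertices. For [k = 0] every chain is a cycle, since
    [bdry] only reads coefficients at nonempty sequences. *)
Definition acyclic A k := forall c, chain_on A k c -> (forall s, bdry c s = 0) ->
  exists2 b, chain_on A k.+1 b & forall s, bdry b s = c s.

Lemma chain_on_sub A B k c : A \subset B -> chain_on A k c -> chain_on B k c.
Proof.
move=> /subsetP AB cA s /cA /and3P[-> -> /=]; apply: sub_all => z; exact: AB.
Qed.

Lemma chain_onD A k c b :
  chain_on A k c -> chain_on A k b -> chain_on A k (fun u => c u + b u).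
Proof.
move=> cA bA s; have [c0|/cA //] := eqVneq (c s) 0.
by rewrite c0 add0r => /bA.
Qed.

Lemma chain_onN A k c : chain_on A k c -> chain_on A k (fun u => - c u).
Proof. by move=> cA s; rewrite oppr_eq0; apply: cA. Qed.

Lemma bdry_chain_on A k c : chain_on A k.+1 c -> chain_on A k (bdry c).
Proof.
move=> cA s /bdry_neq0[s1 [z [s2 [-> /cA /and3P[]]]]].
rewrite !size_cat /= addnS eqSS => -> srt /=.
rewrite !all_cat /= => /and3P[-> _ ->]; rewrite !andbT.
apply: subseq_sorted srt; first exact: lt_trans.
by rewrite cat_subseq // subseq_cons.
Qed.

(** The least element is the apex of a cone: prepending it to the simplices of a cycle that avoid it
    gives a chain whose boundary is that cycle. *)
Lemma acyclic_cone A a k : a \in A -> (forall z, z \in A -> (a <= z)%O) -> acyclic A k.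
Proof.
move=> aA amin c cA c0.
pose b u := if u is z :: u' then if (z == a) && (a \notin u') then c u' else 0 else 0.
have notin x u : c (x :: u) != 0 -> a \notin u.
  move=> /cA /and3P[_ /= srt /andP[/amin ax _]]; apply/negP => au.
  move: (order_path_min lt_trans srt) => /allP/(_ a au) xa.
  by have := le_lt_trans ax xa; rewrite ltxx.
have bA : chain_on A k.+1 b.
  case=> [|z u] /=; first by rewrite eqxx.
  case: ifP => [/andP[/eqP-> nau] cu|_]; last by rewrite eqxx.
  have /and3P[/eqP<- srt allA] := cA _ cu.
  rewrite eqxx aA allA /= andbT path_sortedE; last exact: lt_trans.
  rewrite srt andbT; apply/allP => x xu; rewrite lt_neqAle (amin _ (allP allA _ xu)) andbT.
  by apply: contraNneq nau => ->.
have bE x u : b (x :: u) = if (x == a) && (a \notin u) then c u else 0 by [].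
exists b => // s; have sum_b u : \sum_z b (z :: u) = if a \notin u then c u else 0.
  by rewrite (bigD1 a) //= eqxx big1 ?addr0 // => z /negbTE ->.
have c_notin x u : a \in u -> c (x :: u) = 0.
  by move=> au; apply/eqP; apply: contraTT au => /notin.
clearbody b; case: s => [|x s] /=; rewrite sum_b ?subr0 // inE negb_or eq_sym.
have [->|nxa] := eqVneq x a; last first.
  rewrite (eq_bdry s (b := fun=> 0)) ?bdry0 ?subr0 /=; last by move=> u; rewrite bE (negbTE nxa).
  by case: ifP => // /negbFE/c_notin ->.
rewrite sub0r.
(* Only the boundary of the part of [c] avoiding [a] is left. As [c] is a cycle, it is traded for
   the part containing [a], where, for [s] avoiding [a], only inserting [a] in front contributes. *)
rewrite (eq_bdry s (b := fun u => c u - (if a \in u then c u else 0))); last first.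
  by move=> u; rewrite bE eqxx /=; case: (a \in u); rewrite ?subrr ?subr0.
rewrite bdryB c0 sub0r opprK.
case: s => [|x' s] /=; rewrite (bigD1 a) //= inE eqxx /= big1 ?addr0 ?subr0 //.
- by move=> z /negbTE nza; rewrite inE eq_sym nza.
- rewrite (eq_bdry s (b := fun u => if x' == a then c (x' :: u) else 0)); last first.
    move=> u; rewrite inE eq_sym; case: eqP => //= _.
    by case: ifP => // /c_notin.
  have [ex|nx] := eqVneq x' a; last by rewrite bdry0 subr0.
  have := c0 (x' :: s); rewrite /= => /eqP; rewrite subr_eq0 => /eqP <-.
  by rewrite big1 ?subr0 // => z _; rewrite c_notin // ex inE eqxx.
- move=> z nza; case: ifP => //; rewrite inE eq_sym (negbTE nza) /=.
  exact: c_notin.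
Qed.

(** The cycle is split as [c1 + c2] along [U] and [V]. The boundary of [c1] is a cycle on the
    intersection; a filling [e] of it corrects both halves to cycles, which are filled
    separately. *)
Lemma acyclic_Mayer_Vietoris U V k :
  (forall s, sorted <%O s -> all (mem (U :|: V)) s -> all (mem U) s || all (mem V) s) ->
  acyclic U k -> acyclic V k -> (0 < k -> acyclic (U :&: V) k.-1)%N ->
  acyclic (U :|: V) k.
Proof.
move=> cover acU acV acI c cUV c0.
case: k => [|k] in acU acV acI cUV *.
  have [|b bU bc] := acU c _ c0; last by exists b => //; apply: chain_on_sub bU; apply: subsetUl.
  by move=> s /cUV /and3P[]; case: s.
pose c1 s := if all (mem U) s then c s else 0.
pose c2 s := if all (mem U) s then 0 else c s.
have c12 s : c1 s + c2 s = c s by rewrite /c1 /c2; case: ifP; rewrite ?addr0 ?add0r.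
have c1U : chain_on U k.+1 c1.
  by move=> s; rewrite /c1; case: ifP => [sU /cUV /and3P[-> -> _] //|]; rewrite eqxx.
have c2V : chain_on V k.+1 c2.
  move=> s; rewrite /c2; case: ifP => [|sU /cUV /and3P[-> srt allUV]]; first by rewrite eqxx.
  by have := cover s srt allUV; rewrite sU srt.
have d12 s : bdry c1 s = - bdry c2 s.
  by apply/eqP; rewrite -addr_eq0 -bdryD (eq_bdry _ c12) c0.
(* [bdry c1] lives on [U], and also on [V] because it equals [- bdry c2]. *)
have [||e eI de] := acI isT (bdry c1).
- move=> s nz; have /and3P[-> -> sU] := bdry_chain_on c1U nz.
  rewrite d12 oppr_eq0 in nz; have /and3P[_ _ sV] := bdry_chain_on c2V nz.
  by apply/allP => z zs; apply/setIP; split; [apply: (allP sU) | apply: (allP sV)].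
- exact: bdry_bdry.
have [||b1 b1U db1] := acU (fun s => c1 s + - e s).
- by apply: chain_onD => //; apply: chain_onN; apply: chain_on_sub eI; apply: subsetIl.
- by move=> s; rewrite bdryB de subrr.
have [||b2 b2V db2] := acV (fun s => c2 s + e s).
- by apply: chain_onD => //; apply: chain_on_sub eI; apply: subsetIr.
- by move=> s; rewrite bdryD de d12 subrr.
exists (fun s => b1 s + b2 s).
  by apply: chain_onD; [apply: chain_on_sub b1U | apply: chain_on_sub b2V];
    rewrite ?subsetUl ?subsetUr.
by move=> s; rewrite bdryD db1 db2 addrACA addNr addr0 c12.
Qed.

(** * Comparison with the simplicial chains of the order complex *)

Section SimplicialChains.
Variables (A : {set P}) (k : nat).

(** Extension by zero to all sequences; the sum has at most one term. *)
Definition coef (c : simplicial_chain K A k) s : K :=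
  \sum_(t : simplex A k | val t == s :> seq P) c t.

Lemma coef_val (c : simplicial_chain K A k) (t : simplex A k) : coef c (val t) = c t.
Proof. by rewrite /coef (big_pred1 t) // => t'; rewrite !val_eqE. Qed.

Lemma coef_chain_on (c : simplicial_chain K A k) : chain_on A k (coef c).
Proof.
move=> s; have [/existsP[t /eqP <-] _|/existsPn nt] :=
  boolP [exists t : simplex A k, val t == s :> seq P].
  by rewrite size_tuple eqxx (valP t).
by rewrite /coef big_pred0 ?eqxx // => t; apply/negbTE.
Qed.

Lemma coef_finfun c : chain_on A k c ->
  coef [ffun t : simplex A k => c (val t)] =1 c.
Proof.
move=> cA s; have [cs0|/cA /and3P[sz srt allA]] := eqVneq (c s) 0.
  by rewrite cs0 /coef big1 // => t /eqP es; rewrite ffunE es.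
have tP : sorted <%O (Tuple sz) && all (fun z => z \in A) (Tuple sz) by rewrite /= srt.
by rewrite -[s]/(val (Sub (Tuple sz) tP : simplex A k) : seq P) coef_val ffunE.
Qed.

End SimplicialChains.

(** Unfolds the recursion into a signed sum over insertion positions, to be matched with the faces
    in [boundary]. *)
Lemma bdry_insert c s :
  bdry c s = \sum_(i < (size s).+1) (-1) ^+ i * \sum_z c (take i s ++ z :: drop i s).
Proof.
elim: s c => [|x s IHs] c /=; first by rewrite big_ord_recl big_ord0 mul1r subr0 addr0.
rewrite IHs [RHS]big_ord_recl mul1r /= -sumrN; congr (_ + _).
by apply: eq_bigr => i _; rewrite exprS mulN1r mulNr.
Qed.

(** Insertion at [i] inverts deletion at [i]. The default [z] of [nth] is never reached, since
    [i < size u]. *)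
Lemma face_insert (i : nat) s u (z : P) : (i < size u)%N ->
  (u == take i s ++ z :: drop i s) = (face i u == s) && (nth z u i == z).
Proof.
move=> iu; apply/eqP/andP => [eu|[/eqP <- /eqP nz]].
  have is_ : (i <= size s)%N.
    rewrite leqNgt; apply/negP => si; move: iu.
    by rewrite eu take_oversize ?drop_oversize ?(ltnW si) // size_cat /=; lia.
  have st : size (take i s) = i by rewrite size_takel.
  rewrite eu nth_cat st ltnn subnn /= eqxx /face take_cat st ltnn subnn take0 cats0.
  by rewrite drop_cat st ltnNge leqnSn /= subSn ?leqnn // subnn /= drop0 cat_take_drop.
have st : size (take i u) = i by rewrite size_takel // ltnW.
rewrite /face take_size_cat // drop_size_cat //.
by rewrite -[u in LHS](cat_take_drop i) (drop_nth z iu) nz.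
Qed.

Lemma boundaryE A k (c : simplicial_chain K A k.+1) (s : simplex A k) :
  boundary c s = bdry (coef c) (val s).
Proof.
rewrite ffunE bdry_insert size_tuple.
under eq_bigr => t _ do rewrite big_mkcond.
rewrite exchange_big /=; apply: eq_bigr => i _.
rewrite -big_mkcond -mulr_sumr /=; congr (_ * _).
under [RHS]eq_bigr => z _ do rewrite /coef big_mkcond.
rewrite exchange_big big_mkcond /=; apply: eq_bigr => t _.
have it : (i < size (val t))%N by rewrite size_tuple.
case: ifP => ft; last first.
  by rewrite big1 // => z _; rewrite face_insert // ft.
have [z0 _] : exists z : P, true by case: (tval (val t)) it => // z; exists z.
rewrite (bigD1 (nth z0 (val t) i)) //= face_insert // ft (set_nth_default z0) // eqxx.
rewrite big1 ?addr0 // => z nz; rewrite face_insert // ft (set_nth_default z0) //=.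
by rewrite eq_sym (negbTE nz).
Qed.

Lemma acyclic_reduced_homology A k : acyclic A k -> reduced_homology_vanishes K A k.
Proof.
move=> acA c cyc.
have [|b bA db] := acA (coef c) (@coef_chain_on A k c).
  case: k {acA} c cyc => [|k] c cyc s.
    apply/eqP; apply: contraTT isT => /bdry_neq0[s1 [z [s2 [_ /coef_chain_on]]]].
    by rewrite size_cat addnS.
  (* [boundaryE] settles the simplices; at other sequences the boundary vanishes, its support
     consisting of simplices of [A]. *)
  apply/eqP; apply: contraT => nz.
  have /and3P[sz srt allA] := bdry_chain_on (@coef_chain_on A k.+1 c) nz.
  have tP : sorted <%O (Tuple sz) && all (fun z => z \in A) (Tuple sz) by rewrite /= srt.
  have := boundaryE c (Sub (Tuple sz) tP : simplex A k).
  by rewrite [boundary c]cyc ffunE => e; rewrite -e eqxx in nz.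
exists [ffun t : simplex A k.+1 => b (val t)]; apply/ffunP => s.
by rewrite boundaryE (eq_bdry _ (coef_finfun bA)) db coef_val.
Qed.

End ChainComplex.

(** * Homology of totally semimodular posets *)

Section CohenMacaulay.
Context {d : Order.disp_t} (P : finPOrderType d) (rho : P -> nat).
Hypotheses (gr : graded_by rho) (sm : totally_semimodular P).
Implicit Types (A B : {set P}) (x y z a : P).

(** The union of the half-open intervals from elements of [A] to [y], each nonempty one a cone over
    its least element. *)
Definition open_filter A y := [set z | (z < y)%O & [exists a in A, (a <= z)%O]].

Lemma open_filterP A y z :
  reflect ((z < y)%O /\ exists2 a, a \in A & (a <= z)%O) (z \in open_filter A y).
Proof. by rewrite inE; apply: (iffP andP) => -[zy /exists_inP]. Qed.

Lemma open_filterU A B y : open_filter (A :|: B) y = open_filter A y :|: open_filter B y.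
Proof.
apply/setP => z; apply/open_filterP/setUP.
  by case=> zy [a /setUP[]] aAB az; [left|right]; apply/open_filterP; split=> //; exists a.
by case=> /open_filterP[zy [a aAB az]]; split=> //; exists a; rewrite // inE aAB ?orbT.
Qed.

(** Filters are closed upwards below [y], so the one holding the first vertex of a chain holds all
    of it. *)
Lemma sorted_open_filterU A B y (s : seq P) : sorted <%O s ->
  all (mem (open_filter A y :|: open_filter B y)) s ->
  all (mem (open_filter A y)) s || all (mem (open_filter B y)) s.
Proof.
have up C z (u : seq P) : path <%O z u -> all (< y)%O u -> z \in open_filter C y ->
    all (mem (open_filter C y)) u.
  move=> /(order_path_min lt_trans)/allP zu /allP uy /open_filterP[_ [a aC az]].
  apply/allP => w wu; apply/open_filterP; split; first exact: uy.
  by exists a => //; apply: le_trans az (ltW (zu w wu)).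
case: s => [//|z s] /= zs /andP[zAB /allP sAB].
have sy : all (< y)%O s.
  by apply/allP => w /sAB/setUP[] /open_filterP[].
by case/setUP: zAB => zAB; rewrite zAB (up _ _ _ zs sy zAB) ?orbT.
Qed.

(** Induction on [k], then on the size of [A]. An atom [a] is split off: its cone and the filter of
    the other atoms meet, by semimodularity, in the filter generated by the covers of [a] in [B].
    From [x] to [a] the rank rises by one while [k] drops by one, so the rank bound persists; it
    also keeps [a] different from [y]. *)
Lemma acyclic_open_filter (K : comNzRingType) (k : nat) A x y :
  A != set0 -> (forall a, a \in A -> covers x a && (a <= y)%O) -> k.+1 + rho x < rho y ->
  acyclic K (open_filter A y) k.
Proof.
elim/ltn_ind: k A x => k IHk A x; have [m] := ubnP #|A|.
elim: m A => // m IHm A leAm A0 atA lek.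
have [a aA] := set0Pn _ A0; have /andP[xa ay] := atA a aA.
have rxa := gr.2 _ _ xa.
have ay' : (a < y)%O.
  by rewrite lt_neqAle ay andbT; apply: contraTneq lek => <-; rewrite rxa; lia.
have acy : acyclic K (open_filter [set a] y) k.
  apply: (@acyclic_cone _ _ _ _ a) => [|z /open_filterP[_ [a' /set1P->]] //].
  by apply/open_filterP; split=> //; exists a; rewrite ?inE.
rewrite -(setD1K aA) open_filterU.
have [->|A'0] := eqVneq (A :\ a) set0.
  by rewrite -open_filterU setU0.
have atA' a' : a' \in A :\ a -> [/\ a != a', covers x a' & (a' <= y)%O].
  by rewrite !inE eq_sym => /andP[-> /atA/andP[]].
apply: acyclic_Mayer_Vietoris => //; first exact: sorted_open_filterU.
  apply: IHm => //; last by move=> a' /atA'[_ -> ->].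
  by rewrite (cardsD1 a) aA in leAm.
move=> k0.
pose B := [set b | [&& covers a b, (b <= y)%O & [exists a' in A :\ a, (a' <= b)%O]]].
have joinB a' z : a' \in A :\ a -> (a <= z)%O -> (a' <= z)%O -> (z <= y)%O ->
    exists2 b, b \in B & (b <= z)%O.
  move=> a'A az a'z zy; have [naa' xa' _] := atA' a' a'A.
  have [b [ab a'b bz]] := sm xa xa' naa' az a'z; exists b => //.
  rewrite inE ab (le_trans bz zy); apply/exists_inP; exists a' => //.
  exact: covers_le.
have -> : open_filter [set a] y :&: open_filter (A :\ a) y = open_filter B y.
  apply/setP => z; apply/setIP/open_filterP.
    case=> /open_filterP[zy [_ /set1P-> az]] /open_filterP[_ [a' a'A a'z]].
    by split=> //; apply: joinB a'A az a'z (ltW zy).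
  case=> zy [b]; rewrite inE => /and3P[/covers_le ab _ /exists_inP[a' a'A a'b]] bz.
  split; apply/open_filterP; split=> //.
    by exists a; rewrite ?inE //; apply: le_trans bz.
  by exists a' => //; apply: le_trans bz.
apply: (IHk k.-1 _ B a); first by rewrite prednK.
- have [a' a'A] := set0Pn _ A'0; have [_ _ a'y] := atA' a' a'A.
  by have [b bB _] := joinB a' y a'A ay a'y (lexx y); apply/set0Pn; exists b.
- by move=> b; rewrite inE => /and3P[-> ->].
- by rewrite prednK //; lia.
Qed.

Lemma lt_path_rank x (s : seq P) : path <%O x s -> rho x + size s <= rho (last x s).
Proof.
elim: s x => [|z s IHs] x /=; first by rewrite addn0.
by case/andP => /gr.1 xz /IHs; lia.
Qed.

Lemma interval_length_le x y : interval_length x y <= rho y - rho x.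
Proof.
apply/bigmax_leqP => l /existsP[s /andP[/lt_path_rank]].
by rewrite size_tuple => xs /eqP <-; lia.
Qed.

Lemma chain_interval_length x y (s : seq P) : path <%O x (rcons s y) ->
  size s < interval_length x y.
Proof.
(* [interval_length] ranges over lengths below [#|P|]; this one qualifies because the elements of a
   chain are distinct. *)
move=> srt; have l_lt : (size s).+1 < #|P|.
  have /card_uniqP uq : uniq (x :: rcons s y) by apply: (sorted_uniq lt_trans ltxx).
  by apply: leq_trans (max_card (mem (x :: rcons s y))); rewrite uq /= size_rcons.
apply: (leq_trans _ (@leq_bigmax_cond _ _ (@nat_of_ord _) (Ordinal l_lt) _)) => //; apply/existsP.
have sz : size (rcons s y) == (size s).+1 by rewrite size_rcons.
by exists (Tuple sz); rewrite /= srt last_rcons eqxx.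
Qed.

Theorem semimodular_Cohen_Macaulay_over (K : comNzRingType) : Cohen_Macaulay_over K P.
Proof.
move=> x y xy k nek; apply: acyclic_reduced_homology.
have [ltk|gek|/nek //] := ltngtP k.+1 (interval_length x y); last first.
  (* Above the top degree there is no simplex: [k] vertices would give a chain of length [k.+1] from
     [x] to [y]. *)
  move=> c cA _; exists (fun=> 0%R) => s; rewrite ?eqxx // bdry0.
  apply/eqP; rewrite eq_sym; apply: contraTT gek => /cA /and3P[/eqP <- srt /allP sxy].
  have {}sxy z : z \in s -> (x < z < y)%O by move/sxy; rewrite [mem _ _]inE.
  rewrite -leqNgt; apply: chain_interval_length.
  rewrite (path_sortedE lt_trans) all_rcons xy /=; apply/andP; split.
    by apply/allP => z /sxy/andP[].
  rewrite (sorted_pairwise lt_trans) pairwise_rcons -(sorted_pairwise lt_trans) srt andbT.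
  by apply/allP => z /sxy/andP[].
have lek : k.+1 + rho x < rho y by have := interval_length_le x y; lia.
(* The open interval is the filter of all its atoms, as every element above [x] lies above an
   atom. *)
have -> : [set z | (x < z < y)%O] = open_filter [set a | covers x a & (a <= y)%O] y.
  apply/setP => z; rewrite inE; apply/andP/open_filterP.
    case=> xz zy; split=> //; have [a xa az] := exists_atom gr xz.
    by exists a => //; rewrite inE xa (le_trans az (ltW zy)).
  case=> zy [a]; rewrite inE => /andP[/covers_lt xa _] az; split=> //.
  exact: lt_le_trans az.
apply: acyclic_open_filter lek; last by move=> a; rewrite inE.
have [a xa ay] := exists_atom gr xy.
by apply/set0Pn; exists a; rewrite inE xa.
Qed.

Theorem semimodular_Cohen_Macaulay : Cohen_Macaulay P.
Proof. by split=> [|F]; apply: semimodular_Cohen_Macaulay_over. Qed.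

End CohenMacaulay.

(** * Multi-pointed partitions *)

Section Interval.
Context {d : Order.disp_t} (T : finPOrderType d) (x y : T) (le_xy : (x <= y)%O).
Local Notation I := (closed_interval le_xy).

Lemma closed_interval_le (u v : I) : (u <= v)%O = (val u <= val v)%O.
Proof. by []. Qed.

Lemma closed_interval_lt (u v : I) : (u < v)%O = (val u < val v)%O.
Proof. by rewrite !lt_neqAle closed_interval_le val_eqE. Qed.

(** Closed intervals are convex: anything strictly between [u] and [v] in [T] already belongs to the
    interval. *)
Lemma closed_interval_covers (u v : I) : covers u v = covers (val u) (val v).
Proof.
rewrite /covers closed_interval_lt; congr (_ && _).
apply/forallP/forallP => h z; last first.
  by have := h (val z); rewrite !closed_interval_lt.
apply/negP => /andP[uz zv].
have zI : (x <= z <= y)%O.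
  by rewrite (le_trans (andP (valP u)).1 (ltW uz)) (le_trans (ltW zv) (andP (valP v)).2).
by have := h (Sub z zI); rewrite !closed_interval_lt SubK uz zv.
Qed.

Lemma closed_interval_graded (rho : T -> nat) :
  graded_by rho -> graded_by (rho \o val : I -> nat).
Proof.
case=> lt cov; split=> u v; rewrite ?closed_interval_lt ?closed_interval_covers.
  exact: lt.
exact: cov.
Qed.

Lemma closed_interval_semimodular : totally_semimodular T -> totally_semimodular I.
Proof.
move=> sm t u v w; rewrite !closed_interval_covers !closed_interval_le -val_eqE.
move=> tu tv nuv uw vw; have [z [uz vz zw]] := sm _ _ _ _ tu tv nuv uw vw.
have zI : (x <= z <= y)%O.
  by rewrite (le_trans (andP (valP u)).1 (covers_le uz)) (le_trans zw (andP (valP w)).2).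
by exists (Sub z zI); rewrite !closed_interval_covers closed_interval_le SubK.
Qed.

End Interval.

(** * Blocks, mergers and a blockwise description of the order *)

Section MultiPointed.
Variable n : nat.
Implicit Types (p q t x y z v : mpp n) (b c e f : pointed_block n) (B Q R : {set 'I_n}).

Lemma mpp_cover p (i : 'I_n) : exists2 b, b \in val p & i \in b.1.
Proof. by have [cov _ _] := is_mppP _ (valP p). Qed.

Lemma mpp_inj p b c (i : 'I_n) :
  b \in val p -> c \in val p -> i \in b.1 -> i \in c.1 -> b = c.
Proof. by have [_ inj _] := is_mppP _ (valP p); apply: inj. Qed.

Lemma pointed_neq0 p b : b \in val p -> b.2 != set0.
Proof. by have [_ _ pt] := is_mppP _ (valP p) => /pt/andP[]. Qed.

Lemma pointed_sub p b : b \in val p -> b.2 \subset b.1.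
Proof. by have [_ _ pt] := is_mppP _ (valP p) => /pt/andP[]. Qed.

Lemma block_neq0 p b : b \in val p -> exists i, i \in b.1.
Proof.
by move=> bp; have /set0Pn[i ib] := pointed_neq0 bp; exists i; apply: (subsetP (pointed_sub bp)).
Qed.

Lemma block_disjoint p b c : b \in val p -> c \in val p -> b != c -> b.1 :&: c.1 = set0.
Proof.
move=> bp cp; apply: contraNeq => /set0Pn[i /setIP[ib ic]].
by apply/eqP; apply: (mpp_inj bp cp ib ic).
Qed.

Lemma pointed_disjoint p b c : b \in val p -> c \in val p -> b != c -> b.2 :&: c.1 = set0.
Proof.
move=> bp cp nbc; apply/eqP; rewrite -subset0 -(block_disjoint bp cp nbc).
exact: setSI (pointed_sub bp).
Qed.

(** Successive mergers keep or drop the pointed subset of an initial block as a whole, so these are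
    the only traces that [e.2] can leave on [b]. *)
Definition compat e b :=
  (b.1 \subset e.1) && ((e.2 :&: b.1 == set0) || (e.2 :&: b.1 == b.2)).

Lemma compat_refl p b : b \in val p -> compat b b.
Proof. by move=> /pointed_sub/setIidPl eb; rewrite /compat subxx eb eqxx orbT. Qed.

Lemma compat_trans f e b : compat f e -> compat e b -> compat f b.
Proof.
move=> /andP[ef fe] /andP[be eb]; rewrite /compat (subset_trans be ef) /=.
have -> : f.2 :&: b.1 = f.2 :&: e.1 :&: b.1 by rewrite -setIA (setIidPr be).
by case/orP: fe => /eqP ->; rewrite ?set0I ?eqxx.
Qed.

Definition refines p q := [forall b in val p, exists e in val q, compat e b].

Lemma refinesP p q :
  reflect (forall b, b \in val p -> exists2 e, e \in val q & compat e b) (refines p q).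
Proof.
apply: (iffP forall_inP) => h b bp; first exact/exists_inP/h.
exact/exists_inP/h.
Qed.

Definition merged p b c Q q :=
  [/\ b \in val p, c \in val p, b != c, Q \in [:: b.2; c.2; b.2 :|: c.2]
    & val q = (b.1 :|: c.1, Q) |: (val p :\ b :\ c)].

Lemma mergeP p q : reflect (exists b c Q, merged p b c Q q) (Defs.merge p q).
Proof.
apply: (iffP exists_inP) => [[b bp /exists_inP[c cp /andP[nbc /hasP[Q QP /eqP e]]]]|].
  by exists b, c, Q.
case=> b [c [Q [bp cp nbc QP e]]]; exists b => //; apply/exists_inP; exists c => //.
by rewrite nbc; apply/hasP; exists Q; rewrite // e.
Qed.

Lemma mergedC p b c Q q : merged p b c Q q -> merged p c b Q q.
Proof.
case=> bp cp nbc QP e; split; rewrite 1?eq_sym //.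
  by move: QP; rewrite !inE setUC orbCA.
by rewrite e [b.1 :|: c.1]setUC !setDDl [[set b] :|: _]setUC.
Qed.

Lemma merged_fresh p b c Q q : merged p b c Q q -> (b.1 :|: c.1, Q) \notin val p :\ b :\ c.
Proof.
case=> bp cp nbc _ _; apply/negP; rewrite !inE => /and3P[nc nb mp].
have [i ib] := block_neq0 bp; case/eqP: nb.
by apply: (mpp_inj mp bp _ ib); rewrite inE ib.
Qed.

Lemma merged_card p b c Q q : merged p b c Q q -> #|val p| = #|val q|.+1.
Proof.
move=> m; have fr := merged_fresh m; case: m => bp cp nbc _ ->.
by rewrite cardsU1 fr (cardsD1 b (val p)) bp (cardsD1 c (val p :\ b)) !inE eq_sym nbc cp.
Qed.

Lemma mem_merged p b c Q q e : merged p b c Q q ->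
  (e \in val q) = (e == (b.1 :|: c.1, Q)) || [&& e != c, e != b & e \in val p].
Proof. by case=> _ _ _ _ ->; rewrite !inE. Qed.

Lemma merged_exists p b c Q : b \in val p -> c \in val p -> b != c ->
  Q \in [:: b.2; c.2; b.2 :|: c.2] -> exists q, merged p b c Q q.
Proof.
move=> bp cp nbc QP; pose s := (b.1 :|: c.1, Q) |: (val p :\ b :\ c).
suff sP : is_mpp s by exists (Mpp sP).
have out e i : e \in val p :\ b :\ c -> i \in e.1 -> i \in b.1 :|: c.1 -> False.
  rewrite !inE => /and3P[/eqP nec /eqP neb ep] ie /orP[ib|ic].
    by apply: neb; apply: (mpp_inj ep bp ie ib).
  by apply: nec; apply: (mpp_inj ep cp ie ic).
apply/is_mppP; split.
- move=> i; have [e ep ie] := mpp_cover p i.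
  have [ebc|] := boolP ((e == b) || (e == c)).
    exists (b.1 :|: c.1, Q); first by rewrite !inE eqxx.
    by case/orP: ebc => /eqP <-; rewrite !inE ie ?orbT.
  by rewrite negb_or => /andP[nb nc]; exists e; rewrite // !inE nb nc ep orbT.
- move=> e f i /setU1P[->|es] /setU1P[->|fs] //= ie jf.
  + by case: (out f i).
  + by case: (out e i).
  + by move: es fs; rewrite !inE => /and3P[_ _ ep] /and3P[_ _ fp]; apply: (mpp_inj ep fp ie jf).
- move=> e /setU1P[->|] /=; last first.
    by rewrite !inE => /and3P[_ _ ep]; rewrite (pointed_neq0 ep) (pointed_sub ep).
  have [b0 bs c0 cs] := And4 (pointed_neq0 bp) (pointed_sub bp) (pointed_neq0 cp) (pointed_sub cp).
  move: QP; rewrite !inE => /or3P[] /eqP ->.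
  + by rewrite b0 subsetU // bs.
  + by rewrite c0 subsetU // cs orbT.
  + by rewrite setUSS // andbT setU_eq0 negb_and b0.
Qed.

Lemma merged_compat p b c Q q : merged p b c Q q ->
  compat (b.1 :|: c.1, Q) b.
Proof.
case=> bp cp nbc QP _; rewrite /compat /= subsetUl /=.
have b12 := setIidPl (pointed_sub bp).
have c2b : c.2 :&: b.1 = set0 by apply: (pointed_disjoint cp bp); rewrite eq_sym.
by move: QP; rewrite !inE => /or3P[] /eqP ->; rewrite ?setIUl ?b12 ?c2b ?setU0 eqxx ?orbT.
Qed.

Lemma merged_refines_to p b c Q q : merged p b c Q q -> refines p q.
Proof.
move=> m; apply/refinesP => e ep.
have [->|neb] := eqVneq e b.
  by exists (b.1 :|: c.1, Q); rewrite ?(mem_merged _ m) ?eqxx //; apply: merged_compat m.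
have [->|nec] := eqVneq e c.
  exists (b.1 :|: c.1, Q); first by rewrite (mem_merged _ m) eqxx.
  by rewrite setUC; apply: merged_compat (mergedC m).
by exists e; rewrite ?(mem_merged _ m) ?neb ?nec ?ep ?orbT //; apply: compat_refl ep.
Qed.

Lemma merged_refines p b c Q q v e : merged p b c Q q -> refines p v ->
  e \in val v -> compat e (b.1 :|: c.1, Q) -> refines q v.
Proof.
move=> m /refinesP pv ev eb; apply/refinesP => f.
rewrite (mem_merged _ m) => /orP[/eqP ->|/and3P[_ _ /pv //]].
by exists e.
Qed.

(** The trace of [e.2] on the union is one of the three choices unless it is empty; then every
    choice is compatible and [b.2] is taken. *)
Lemma exists_pointing e b c : compat e b -> compat e c ->
  exists2 Q, Q \in [:: b.2; c.2; b.2 :|: c.2] & compat e (b.1 :|: c.1, Q).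
Proof.
move=> /andP[be eb] /andP[ce ec].
exists (if e.2 :&: (b.1 :|: c.1) == set0 then b.2 else e.2 :&: (b.1 :|: c.1)); last first.
  by rewrite /compat /= subUset be ce /=; case: ifP => //; rewrite eqxx orbT.
case: ifP; first by rewrite !inE eqxx.
rewrite setIUr !inE; case/orP: eb => /eqP ->; case/orP: ec => /eqP ->.
all: by rewrite ?setU0 ?set0U ?eqxx ?orbT.
Qed.

(** A merger refines, and refinement is transitive. Conversely, as long as a block of [q] hosts two
    blocks of [p], these are merged with a pointing compatible with it, by induction on the number
    of blocks. *)
Lemma le_refines p q : (p <= q)%O = refines p q.
Proof.
apply/idP/idP.
  case/connectP => s; elim: s p => [|r s IHs] p /=.
    by move=> _ ->; apply/refinesP => b bp; exists b; rewrite ?(compat_refl bp).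
  case/andP => /mergeP[b [c [Q m]]] rs /(IHs r rs)/refinesP rq.
  have /refinesP pr := merged_refines_to m; apply/refinesP => e /pr[f /rq[g gq gf] fe].
  by exists g; rewrite // (compat_trans gf fe).
have [m] := ubnP #|val p|; elim: m p => // m IHm p lem /refinesP pq.
have [/exists_inP[e eq /exists_inP[b bp /exists_inP[c cp /and3P[nbc eb ec]]]]|] := boolP
  [exists e in val q, exists b in val p, exists c in val p, [&& b != c, compat e b & compat e c]].
  have [Q QP eQ] := exists_pointing eb ec.
  have [p' mp] := merged_exists bp cp nbc QP.
  apply: (@le_trans _ _ p'); first by apply: connect1; apply/mergeP; exists b, c, Q.
  apply: IHm; first by rewrite (merged_card mp) in lem.
  by apply: merged_refines mp _ eq eQ; apply/refinesP.
(* Each block of [q] now hosts at most one block of [p], so the underlying blocks agree; the pointed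
   subset in [q] is nonempty, hence equal to that in [p]. *)
move=> none; suff -> : p = q by apply: lexx.
have one e b c : e \in val q -> b \in val p -> c \in val p -> compat e b -> compat e c -> b = c.
  move=> eq bp cp eb ec; apply/eqP; apply: contraNT none => nbc.
  apply/exists_inP; exists e => //; apply/exists_inP; exists b => //.
  by apply/exists_inP; exists c; rewrite ?nbc ?eb.
have pq' b : b \in val p -> b \in val q.
  move=> bp; have [e eq eb] := pq b bp; case/andP: (eb) => be /orP bP.
  have ebl : e.1 = b.1.
    apply/eqP; rewrite eqEsubset be andbT; apply/subsetP => i ie.
    have [c cp ic] := mpp_cover p i; have [f fq fc] := pq c cp.
    have ef : f = e by apply: (mpp_inj fq eq _ ie); apply: (subsetP (andP fc).1).
    by rewrite ef in fc; rewrite (one e b c).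
  move: bP; rewrite -ebl (setIidPl (pointed_sub eq)) (negbTE (pointed_neq0 eq)) => -[//|/eqP e2].
  by rewrite [b]surjective_pairing -ebl -e2 -surjective_pairing.
apply: val_inj; apply/setP => b; apply/idP/idP => [/pq' //|bq].
have [i ib] := block_neq0 bq; have [c cp ic] := mpp_cover p i.
by rewrite (mpp_inj bq (pq' c cp) ib ic).
Qed.

Lemma merge_lt p q : Defs.merge p q -> (p < q)%O.
Proof.
move=> m; rewrite lt_neqAle; apply/andP; split; last exact: connect1.
by apply: contraTneq (merge_card m) => ->; rewrite ltnn.
Qed.

Lemma lt_card p q : (p < q)%O -> #|val q| < #|val p|.
Proof.
rewrite lt_neqAle => /andP[/eqP npq]; by case/connect_merge_card.
Qed.

(** A merger lowers the number of blocks by exactly one, leaving no room in between; conversely, the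
    first merger on a path from [p] to [q] must already reach [q]. *)
Lemma coversE p q : covers p q = Defs.merge p q.
Proof.
apply/idP/idP => [/andP[lt /forallP none]|m]; last first.
  rewrite /covers (merge_lt m); apply/forallP => z; apply/negP => /andP[/lt_card pz /lt_card zq].
  by case/mergeP: m => b [c [Q /merged_card e]]; lia.
case/connectP: (ltW lt) => -[|r s] /=; first by move=> _ e; rewrite e ltxx in lt.
case/andP => m rs eq.
have rq : (r <= q)%O by apply/connectP; exists s.
have := none r; rewrite (merge_lt m) /= lt_neqAle rq andbT negbK => /eqP <- //.
Qed.

(** Up to an additive constant, [n] minus the number of blocks; subtracting from an upper bound
    avoids truncation. *)
Definition mpp_rank p := #|{: pointed_block n}| - #|val p|.

Lemma mpp_graded : graded_by mpp_rank.
Proof.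
have bound p : #|val p| <= #|{: pointed_block n}| by apply: max_card.
split=> p q; rewrite /mpp_rank; have := bound p.
  by move=> bp /lt_card; lia.
by rewrite coversE => bp /mergeP[b [c [Q /merged_card]]]; lia.
Qed.

Lemma merged_le p b c Q q v : merged p b c Q q -> (q <= v)%O ->
  exists2 e, e \in val v & compat e (b.1 :|: c.1, Q).
Proof.
move=> m; rewrite le_refines => /refinesP; apply.
by rewrite (mem_merged _ m) eqxx.
Qed.

Lemma merged_merge p b c Q q : merged p b c Q q -> Defs.merge p q.
Proof. by move=> m; apply/mergeP; exists b, c, Q. Qed.

Lemma merged_rest p b c Q q : merged p b c Q q ->
  val q :\ (b.1 :|: c.1, Q) = val p :\ b :\ c.
Proof. by move=> m; have fr := merged_fresh m; case: m => _ _ _ _ ->; rewrite setU1K. Qed.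

Lemma merged_new_neq p b c Q q e : merged p b c Q q -> e \in val p -> e != b ->
  (b.1 :|: c.1, Q) != e.
Proof.
case=> bp _ _ _ _ ep; apply: contraNneq => E; have [i ib] := block_neq0 bp.
by apply/eqP; apply: (mpp_inj ep bp _ ib); rewrite -E inE ib.
Qed.

Lemma merged_stable p b c Q q e : merged p b c Q q -> e \in val p -> e != b -> e != c ->
  e \in val q.
Proof. by move=> m ep nb nc; rewrite (mem_merged _ m) ep nb nc orbT. Qed.

Lemma merged_new p b c Q q : merged p b c Q q -> (b.1 :|: c.1, Q) \in val q.
Proof. by move=> m; rewrite (mem_merged _ m) eqxx. Qed.

(** * Common covers of two mergers *)

Lemma merged_twice t b c Q x f R z :
  merged t b c Q x -> merged x (b.1 :|: c.1, Q) f R z ->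
  val z = (b.1 :|: c.1 :|: f.1, R) |: (val t :\ b :\ c :\ f).
Proof. by move=> /merged_rest <- [_ _ _ _ ->]. Qed.

(** With four distinct blocks the two mergers commute, and [y <= v] provides the block of [v]
    hosting the second one. *)
Lemma join_disjoint t x y v b c Q b' c' Q' :
  merged t b c Q x -> merged t b' c' Q' y ->
  b' != b -> b' != c -> c' != b -> c' != c -> (x <= v)%O -> (y <= v)%O ->
  exists z, [/\ Defs.merge x z, Defs.merge y z & (z <= v)%O].
Proof.
move=> mx my nb'b nb'c nc'b nc'c xv yv.
have [bt ct nbc QP ex] := mx; have [b't c't nbc' QP' ey] := my.
have [||z mz] := @merged_exists x b' c' Q' _ _ nbc' QP'; try exact: (merged_stable mx).
have [||z' mz'] := @merged_exists y b c Q _ _ nbc QP;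
  try by apply: (merged_stable my); rewrite // eq_sym.
have E : z' = z.
  apply: val_inj; case: mz mz' => _ _ _ _ -> [_ _ _ _ ->]; rewrite ex ey.
  have [B1 B2] := (merged_new_neq mx b't nb'b, merged_new_neq mx c't nc'b).
  have [B1' B2'] : (b'.1 :|: c'.1, Q') != b /\ (b'.1 :|: c'.1, Q') != c.
    by split; apply: (merged_new_neq my) => //; rewrite eq_sym.
  apply/setP => e; rewrite !inE.
  have [->|_] := eqVneq e (b.1 :|: c.1, Q); first by rewrite B1 B2 orbT.
  have [->|_] := eqVneq e (b'.1 :|: c'.1, Q'); first by rewrite B1' B2'.
  by case: (e == b); case: (e == c); case: (e == b'); case: (e == c').
exists z; split; [exact: merged_merge mz | by rewrite -E; exact: merged_merge mz' |].
have [e ev eB] := merged_le my yv.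
by rewrite !le_refines in xv *; apply: merged_refines mz xv ev eB.
Qed.

Lemma compat_new p b c Q q e : merged p b c Q q ->
  compat e (b.1 :|: c.1, Q) -> compat e c.
Proof. by move=> /mergedC/merged_compat m; rewrite setUC => eB; apply: compat_trans eB m. Qed.

Lemma compat_pointing e B Q : e.2 :&: B != set0 -> compat e (B, Q) -> Q = e.2 :&: B.
Proof. by move=> /negbTE nz /andP[_]; rewrite nz => /eqP. Qed.

Lemma compat_empty e B Q : B \subset e.1 -> e.2 :&: B = set0 -> compat e (B, Q).
Proof. by rewrite /compat => -> /= ->; rewrite eqxx. Qed.

(** If [e.2] meets the three blocks, its trace is the only compatible pointing and both routes lead
    to it. Otherwise any pointing is compatible, and one reachable by both routes is chosen by
    hand. *)
Lemma overlap_pointing t x y b c Q c' Q' e :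
  merged t b c Q x -> merged t b c' Q' y ->
  compat e (b.1 :|: c.1, Q) -> compat e (b.1 :|: c'.1, Q') ->
  exists R, [/\ R \in [:: Q; c'.2; Q :|: c'.2], R \in [:: Q'; c.2; Q' :|: c.2]
              & compat e (b.1 :|: c.1 :|: c'.1, R)].
Proof.
move=> mx my ex ey.
have [R RP Re] := exists_pointing ex (compat_new my ey).
have [R' RP' Re'] := exists_pointing ey (compat_new mx ex).
have [D0|D] := eqVneq (e.2 :&: (b.1 :|: c.1 :|: c'.1)) set0; last first.
  exists R; split=> //; move: RP'; rewrite /= setUAC in Re'.
  by rewrite (compat_pointing D Re) -(compat_pointing D Re').
have sub := (andP Re).1.
case: mx => _ _ _ QP _; case: my => _ _ _ QP' _.
suff [R0 h h'] : exists2 R0, R0 \in [:: Q; c'.2; Q :|: c'.2] & R0 \in [:: Q'; c.2; Q' :|: c.2].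
  by exists R0; split=> //; apply: compat_empty.
(* If [Q = c.2] then [c.2] serves, and if [Q' = c'.2] then [c'.2] does. Otherwise [Q] and [Q']
   contain [b.2], so [Q :|: Q'] adds at most [c'.2] to [Q] and at most [c.2] to [Q']. *)
have [->|nQ] := eqVneq Q c.2; first by exists c.2; rewrite !inE eqxx ?orbT.
have [->|nQ'] := eqVneq Q' c'.2; first by exists c'.2; rewrite !inE eqxx ?orbT.
move: QP QP'; rewrite !inE (negbTE nQ) (negbTE nQ') /= => QP QP'.
have bQ : Q :|: b.2 = Q by case/orP: QP => /eqP ->; rewrite ?setUid // setUAC setUid.
have bQ' : Q' :|: b.2 = Q' by case/orP: QP' => /eqP ->; rewrite ?setUid // setUAC setUid.
exists (Q :|: Q'); rewrite !inE.
  by case/orP: QP' => /eqP ->; rewrite ?setUA bQ eqxx ?orbT.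
by rewrite setUC; case/orP: QP => /eqP ->; rewrite ?setUA bQ' eqxx ?orbT.
Qed.

(** Absorbing the third block on either side yields the same block with the same pointing [R], hence
    the same partition. *)
Lemma join_triple t x y v b c c' Q Q' R e :
  merged t b c Q x -> merged t b c' Q' y -> c != c' -> (x <= v)%O ->
  R \in [:: Q; c'.2; Q :|: c'.2] -> R \in [:: Q'; c.2; Q' :|: c.2] ->
  e \in val v -> compat e (b.1 :|: c.1 :|: c'.1, R) ->
  exists z, [/\ Defs.merge x z, Defs.merge y z & (z <= v)%O].
Proof.
move=> mx my ncc' xv RP RP' ev eR.
have [bt ct nbc _ _] := mx; have [_ c't nbc' _ _] := my.
have [|||//|z mz] := @merged_exists x (b.1 :|: c.1, Q) c' R; first exact: merged_new mx.
- by apply: (merged_stable mx); rewrite // eq_sym.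
- by apply: (merged_new_neq mx); rewrite // eq_sym.
have [|||//|z' mz'] := @merged_exists y (b.1 :|: c'.1, Q') c R; first exact: merged_new my.
- by apply: (merged_stable my); rewrite // eq_sym.
- by apply: (merged_new_neq my); rewrite // eq_sym.
have E : z' = z.
  apply: val_inj; rewrite (merged_twice mx mz) (merged_twice my mz') setUAC.
  by rewrite (setDDl (val t :\ b)) [[set c'] :|: _]setUC -setDDl.
exists z; split; [exact: merged_merge mz | by rewrite -E; exact: merged_merge mz' |].
by rewrite !le_refines in xv *; apply: merged_refines mz xv ev eR.
Qed.

(** The shared block [b] puts both new blocks in the same block [e] of [v], so that a common
    pointing [R] exists. *)
Lemma join_overlap t x y v b c c' Q Q' :
  merged t b c Q x -> merged t b c' Q' y -> c != c' -> (x <= v)%O -> (y <= v)%O ->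
  exists z, [/\ Defs.merge x z, Defs.merge y z & (z <= v)%O].
Proof.
move=> mx my ncc' xv yv.
have [e ev ex] := merged_le mx xv; have [f fv fy] := merged_le my yv.
have ef : f = e.
  have [bt _ _ _ _] := mx; have [i ib] := block_neq0 bt.
  apply: (mpp_inj fv ev (i := i)).
    by apply: (subsetP (andP fy).1); rewrite inE ib.
  by apply: (subsetP (andP ex).1); rewrite inE ib.
rewrite {f}ef in fv fy.
have [R [RP RP' eR]] := overlap_pointing mx my ex fy.
exact: join_triple mx my ncc' xv RP RP' ev eR.
Qed.

(* If two different pointings of [b.1 :|: c.1] are both compatible with the same
   block of [v], the pointed part of the latter avoids [b.1 :|: c.1], hence meets a
   third block [f] of [t], whose pointed part serves for the join. *)
Lemma join_same t x y v b c Q Q' :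
  merged t b c Q x -> merged t b c Q' y -> Q != Q' -> (x <= v)%O -> (y <= v)%O ->
  exists z, [/\ Defs.merge x z, Defs.merge y z & (z <= v)%O].
Proof.
move=> mx my nQQ' xv yv; have [bt ct nbc _ _] := mx.
have [e ev ex] := merged_le mx xv; have [e' ev' ey] := merged_le my yv.
have [i ib] := block_neq0 bt.
have ee : e' = e.
  by apply: (mpp_inj ev' ev (i := i));
    [apply: (subsetP (andP ey).1) | apply: (subsetP (andP ex).1)];
    rewrite inE ib.
rewrite {e'}ee in ev' ey.
have D0 : e.2 :&: (b.1 :|: c.1) = set0.
  apply/eqP; apply: contraNT nQQ' => D.
  by rewrite (compat_pointing D ex) (compat_pointing D ey).
have [j je] := set0Pn _ (pointed_neq0 ev); have [f ft jf] := mpp_cover t j.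
have notin : j \notin b.1 :|: c.1.
  by apply/negP => jbc; move/setP/(_ j): D0; rewrite !inE je -in_setU jbc.
have nfb : f != b by apply: contraNneq notin => <-; rewrite inE jf.
have nfc : f != c by apply: contraNneq notin => <-; rewrite inE jf orbT.
have fx := merged_stable mx ft nfb nfc; have fy := merged_stable my ft nfb nfc.
have [||z mz] := @merged_exists x (b.1 :|: c.1, Q) f f.2 (merged_new mx) fx.
- exact: merged_new_neq mx ft nfb.
- by rewrite !inE eqxx orbT.
have [||z' mz'] := @merged_exists y (b.1 :|: c.1, Q') f f.2 (merged_new my) fy.
- exact: merged_new_neq my ft nfb.
- by rewrite !inE eqxx orbT.
have E : z' = z by apply: val_inj; rewrite (merged_twice mx mz) (merged_twice my mz').
exists z; split; [exact: merged_merge mz | by rewrite -E; exact: merged_merge mz' |].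
rewrite !le_refines in xv *; apply: (merged_refines mz xv ev).
have /refinesP/(_ f fx)[e' ev'' ef] := xv.
have ee : e' = e.
  by apply: (mpp_inj ev'' ev (i := j));
    [apply: (subsetP (andP ef).1) | apply: (subsetP (pointed_sub ev))].
rewrite {e'}ee /compat in ev'' ef *; case/andP: ef => fe ef.
by rewrite /= subUset (andP ex).1 fe /= setIUr D0 set0U.
Qed.

(** The cases are sorted by the blocks shared by the two mergers; by the symmetry [mergedC] a shared
    block may be taken as the first of each pair. *)
Theorem mpp_semimodular : totally_semimodular (mpp n).
Proof.
move=> t x y v; rewrite !coversE => /mergeP[b [c [Q mx]]] /mergeP[b' [c' [Q' my]]] nxy xv yv.
suff [z [xz yz zv]] : exists z, [/\ Defs.merge x z, Defs.merge y z & (z <= v)%O].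
  by exists z; rewrite !coversE.
have key b1 c1 c2 : merged t b1 c1 Q x -> merged t b1 c2 Q' y ->
    exists z, [/\ Defs.merge x z, Defs.merge y z & (z <= v)%O].
  move=> m1 m2; have [e|nc] := eqVneq c1 c2; last exact: join_overlap m1 m2 nc xv yv.
  subst c2; apply: (join_same m1 m2 _ xv yv).
  apply: contraNneq nxy => e; apply/eqP/val_inj.
  by case: m1 m2 => _ _ _ _ -> [_ _ _ _ ->]; rewrite e.
have [e|n1] := eqVneq b' b; first by rewrite e in my; apply: key mx my.
have [e|n2] := eqVneq b' c; first by rewrite e in my; apply: key (mergedC mx) my.
have [e|n3] := eqVneq c' b; first by rewrite e in my; apply: key mx (mergedC my).
have [e|n4] := eqVneq c' c; first by rewrite e in my; apply: key (mergedC mx) (mergedC my).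
exact: join_disjoint mx my n1 n2 n3 n4 xv yv.
Qed.

End MultiPointed.

Theorem theorem2p7 (n i : nat) (S : {set 'I_n}) (p : mpp n) :
  1 <= n -> 1 <= i <= n -> #|S| = i -> val p = [set ([set: 'I_n], S)] ->
  CL_shellable (closed_interval (le0x p)) /\
  Cohen_Macaulay (closed_interval (le0x p)).
Proof.
move=> _ _ _ _.
have gr := closed_interval_graded (le0x p) (@mpp_graded n).
have sm := closed_interval_semimodular (le_xy := le0x p) (@mpp_semimodular n).
split; first exact: semimodular_CL_shellable gr sm.
exact: semimodular_Cohen_Macaulay gr sm.
Qed.
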